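(* Let $\lambda_1,\lambda_2>0$. For integers $n\ge\max(\lambda_1,\lambda_2)$ let $P_n=\mathrm{Ber}(\lambda_1/n)$ and $Q_n=\mathrm{Ber}(\lambda_2/n)$ on $\{0,1\}$, and let $f_n=T(P_n,Q_n)$. Then, as $n\to\infty$, $f_n^{\otimes n}\to f_\infty=T(P(\lambda_1),P(\lambda_2))$ pointwise on $[0,1]$.
   Context: $\mathrm{Ber}(\theta)$ is the law on $\{0,1\}$ with mass $\theta$ at $1$ and $1-\theta$ at $0$. $P(\lambda)$ is the Poisson distribution on $\mathbb{Z}_{\ge0}$ with mean $\lambda$. For probability measures $P,Q$ on a measurable space $(\mathcal W,\mathcal F)$, the trade-off function $T(P,Q):[0,1]\to[0,1]$ is $$T(P,Q)(\alpha)=\inf\{\mathbb{E}_Q[1-\varphi] : \varphi:(\mathcal W,\mathcal F)\to[0,1]\text{ measurable},\ \mathbb{E}_P[\varphi]\le\alpha\}.$$ If $f=T(P,Q)$ and $g=T(P',Q')$, then $f\otimes g:=T(P\otimes P',Q\otimes Q')$ (independent of the representations), so that $f_n^{\otimes n}=T(P_n^{\otimes n},Q_n^{\otimes n})$. *)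

(* Defs.v *)
From HB Require Import structures.
From mathcomp Require Import all_boot all_order all_algebra.
From mathcomp Require Import all_classical all_reals all_analysis.

Set Implicit Arguments.
Unset Strict Implicit.
Unset Printing Implicit Defensive.

Import Order.TTheory GRing.Theory Num.Theory.
Import numFieldNormedType.Exports.

Local Open Scope classical_set_scope.
Local Open Scope ring_scope.

Section tradeoff.
Context d (T : measurableType d) (R : realType).

Definition level_tests (P : probability T R) (alpha : R) : set (T -> R) :=
  [set phi : T -> R | [/\ measurable_fun [set: T] phi,
                 forall x, 0 <= phi x <= 1 &
                 ('E_P[phi] <= alpha%:E)%E]].

(* [fine] loses nothing here, as [0 <= 1 - phi <= 1].  The set is nonempty
   exactly when [0 <= alpha] (take [phi = 0]); only [0 <= alpha <= 1] is
   meaningful. *)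
Definition tradeoff (P Q : probability T R) (alpha : R) : R :=
  inf [set fine 'E_Q[fun x => 1 - phi x] | phi in level_tests P alpha].

End tradeoff.

Section power_probability.
Context d (T : measurableType d) (R : realType).

Definition tuple_cons n (x : T * n.-tuple T) : n.+1.-tuple T :=
  [tuple of x.1 :: x.2].

Lemma measurable_tuple_cons n : measurable_fun [set: T * n.-tuple T] (@tuple_cons n).
Proof.
exact: (@measurable_cons _ _ _ _ fst n snd measurable_fst measurable_snd).
Qed.

HB.instance Definition _ n :=
  isMeasurableFun.Build _ _ _ _ (@tuple_cons n) (@measurable_tuple_cons n).

(* The n-fold product of P, on the product sigma-algebra of [n.-tuple T]:
   the image of [P \x P^n] under [(x, t) |-> x :: t]. *)
Fixpoint power_probability (P : probability T R) n :
    probability (n.-tuple T) R :=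
  match n with
  | 0 => \d_[tuple]
  | m.+1 => distribution (P \x power_probability P m)%E (@tuple_cons m)
  end.

Lemma power_probability_box (P : probability T R) n (A : 'I_n -> set T) :
  (forall i, measurable (A i)) ->
  power_probability P n [set t | forall i, A i (tnth t i)] =
  (\prod_(i < n) P (A i))%E.
Proof.
elim: n A => [|n IH] A mA /=.
  by rewrite big_ord0 diracE mem_set// => -[].
rewrite big_ord_recl -IH// -product_measure1E//; last first.
  rewrite (_ : mkset _ = \bigcap_(i in [set: 'I_n])
      ((fun t : n.-tuple T => tnth t i) @^-1` A (lift ord0 i))); last first.
    by apply/seteqP; split=> [t At i _|t At i]; [exact: At|exact: At].
  apply: fin_bigcap_measurable => // i _; rewrite -[X in measurable X]setTI.
  exact: (measurable_tnth i).
rewrite /distribution /pushforward; congr (product_measure1 _ _ _).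
apply/seteqP; split=> [[x t]/= At|[x t]/= [Ax At] i].
  split; first by have := At ord0.
  by move=> i; have := At (lift ord0 i); rewrite /tuple_cons tnthS.
by case: (unliftP ord0 i) => [j|] ->; rewrite /tuple_cons ?tnthS// tnth0.
Qed.

End power_probability.

(* The library's [poisson_prob] takes a second argument that it never uses. *)
Definition poisson (R : realType) (lambda : R) : probability nat R :=
  poisson_prob lambda 0%N.

(* [{0, 1}] is [bool], with [true] for 1.  The law is the intended one for
   [0 <= theta <= 1]; otherwise it is the Dirac mass at [false]. *)
Definition Ber (R : realType) (theta : R) : probability bool R :=
  bernoulli_prob theta.

(* Main.v *)
(* The number of ones is a sufficient statistic for the pair of product
   Bernoulli laws, so the n-fold trade-off function is the one of the binomial
   laws B(n, lambda1/n) and B(n, lambda2/n).  These converge to the Poisson laws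
   pointwise, hence in total variation.  For alpha > 0 a trade-off function is
   continuous in total variation: a test that slightly exceeds the level alpha
   is brought back to it by a factor close to 1.  At alpha = 0 mutual absolute
   continuity makes both sides equal to 1. *)
Require Import Defs.
From mathcomp Require Import all_boot all_order all_algebra.
From mathcomp Require Import all_classical all_reals all_analysis.
From mathcomp Require Import measurable_realfun ring lra.

Import Order.TTheory GRing.Theory Num.Theory.
Import numFieldNormedType.Exports.
Local Open Scope classical_set_scope.
Local Open Scope ring_scope.

Set Implicit Arguments.
Unset Strict Implicit.
Unset Printing Implicit Defensive.

(** * Tests and their means *)

Definition is_test d (T : measurableType d) (R : realType) (phi : T -> R) : Prop :=
  measurable_fun [set: T] phi /\ forall x, 0 <= phi x <= 1.

(** For a test the expectation lies between 0 and 1, so [fine] loses nothing and the estimates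
    become real arithmetic. *)
Definition mean d (T : measurableType d) (R : realType) (P : probability T R)
  (phi : T -> R) : R := fine ('E_P[phi])%E.

Section mean.
Context d (T : measurableType d) (R : realType).
Implicit Types (P Q : probability T R) (phi : T -> R).

Lemma is_test_cst (c : R) : 0 <= c <= 1 -> is_test (fun _ : T => c).
Proof. by move=> c01; split => //; exact: measurable_cst. Qed.

Lemma is_test_onem phi : is_test phi -> is_test (fun x => 1 - phi x).
Proof.
move=> [mphi phi01]; split; first exact: measurable_funB.
by move=> x; have := phi01 x; lra.
Qed.

Lemma is_testZ (c : R) phi : 0 <= c <= 1 -> is_test phi ->
  is_test (fun x => c * phi x).
Proof.
move=> c01 [mphi phi01]; split; first exact: measurable_funM.
by move=> x; have := phi01 x; nra.
Qed.

Lemma expectation_test_bounds P phi : is_test phi ->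
  (0 <= 'E_P[phi] <= 1)%E.
Proof.
move=> [mphi phi01]; apply/andP; split.
  by apply: expectation_ge0 => x; have /andP[] := phi01 x.
rewrite -(expectation_cst P 1); apply: expectation_le => //.
- by move=> x; have /andP[] := phi01 x.
- by apply: aeW => x; have /andP[] := phi01 x.
Qed.

Lemma expectation_meanE P phi : is_test phi ->
  ('E_P[phi])%E = (mean P phi)%:E.
Proof.
move=> /(expectation_test_bounds P)/andP[E0 E1]; rewrite /mean fineK//.
by rewrite ge0_fin_numE// (le_lt_trans E1)// ltry.
Qed.

Lemma mean01 P phi : is_test phi -> 0 <= mean P phi <= 1.
Proof.
move=> tphi; rewrite -!lee_fin -expectation_meanE//.
exact: expectation_test_bounds.
Qed.

Lemma integrable_test P phi : is_test phi ->
  P.-integrable [set: T] (EFin \o phi).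
Proof.
move=> [mphi phi01].
apply: (@le_integrable _ _ _ P [set: T] measurableT _ (cst 1%:E)).
- exact/measurable_EFinP.
- by move=> x _ /=; have /andP[? ?] := phi01 x; rewrite normr1 lee_fin ger0_norm.
- exact: finite_measure_integrable_cst.
Qed.

Lemma Lfun_test P phi : is_test phi -> phi \in Lfun P 1.
Proof. by move=> tphi; apply/Lfun1_integrable; exact: integrable_test. Qed.

Lemma mean_cst P (c : R) : mean P (fun=> c) = c.
Proof. by rewrite /mean (expectation_cst P c). Qed.

Lemma mean_onem P phi : is_test phi ->
  mean P (fun x => 1 - phi x) = 1 - mean P phi.
Proof.
move=> tphi; apply: EFin_inj; rewrite -expectation_meanE; last exact: is_test_onem.
have t1 : is_test (cst 1 : T -> R) by apply: is_test_cst; lra.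
rewrite (expectationB (Lfun_test P t1) (Lfun_test P tphi)).
by rewrite expectation_cst expectation_meanE.
Qed.

Lemma meanZ P (c : R) phi : 0 <= c <= 1 -> is_test phi ->
  mean P (fun x => c * phi x) = c * mean P phi.
Proof.
move=> c01 tphi; apply: EFin_inj; rewrite -expectation_meanE; last exact: is_testZ.
rewrite EFinM -expectation_meanE// -expectationZl ?Lfun_test//.
by congr expectation; apply/funext => x /=; rewrite mulrC.
Qed.

Lemma le_mean P phi psi : is_test phi -> is_test psi ->
  (forall x, phi x <= psi x) -> mean P phi <= mean P psi.
Proof.
move=> tphi tpsi le_phi; rewrite -lee_fin -!expectation_meanE//.
case: tphi tpsi => [mphi phi01] [mpsi psi01].
apply: expectation_le => //.
- by move=> x; have /andP[] := phi01 x.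
- by move=> x; have /andP[] := psi01 x.
- exact: aeW.
Qed.

(** Serves both the truncation of a test on [nat] and the expansion of a function on bit tuples over
    singletons. *)
Lemma mean_step P (I : Type) (s : seq I) (c : I -> R) (A : I -> set T) :
  (forall i, 0 <= c i) -> (forall i, measurable (A i)) ->
  mean P (fun x => \sum_(i <- s) c i * \1_(A i) x) =
  \sum_(i <- s) c i * fine (P (A i)).
Proof.
move=> c0 mA; rewrite /mean unlock.
under eq_integral do rewrite -sumEFin.
rewrite ge0_integral_sum//; first last.
- by move=> i x _; rewrite lee_fin mulr_ge0.
- by move=> i; apply/measurable_EFinP; apply: measurable_funM => //;
    exact: measurable_indic.
rewrite (eq_bigr (fun i => (c i * fine (P (A i)))%:E)); first by rewrite sumEFin.
move=> i _; under eq_integral do rewrite EFinM.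
rewrite ge0_integralZl//; last 2 first.
- by apply/measurable_EFinP; exact: measurable_indic.
- by rewrite lee_fin.
by rewrite integral_indic// setIT EFinM fineK// fin_num_measure.
Qed.

End mean.

(** * Bounds and comparisons for trade-off functions *)

Section tradeoff.
Context d (T : measurableType d) (R : realType).
Implicit Types (P Q : probability T R) (phi : T -> R).

Lemma tradeoff_le P Q alpha phi : is_test phi ->
  mean P phi <= alpha -> tradeoff P Q alpha <= 1 - mean Q phi.
Proof.
move=> tphi lealpha; rewrite /tradeoff -mean_onem//; apply: ge_inf.
  exists 0 => _ [psi [mpsi psi01 _] <-].
  by have /andP[] := mean01 Q (is_test_onem (conj mpsi psi01)).
case: (tphi) => mphi phi01.
by exists phi => //; split => //; rewrite expectation_meanE.
Qed.

(** With [tradeoff_le], the only access to the infimum from here on. Since [0 <= alpha], the zero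
    test is admissible and the infimum is not over the empty set. *)
Lemma tradeoff_ge P Q alpha (c : R) : 0 <= alpha ->
  (forall phi, is_test phi -> mean P phi <= alpha ->
    c <= 1 - mean Q phi) ->
  c <= tradeoff P Q alpha.
Proof.
move=> alpha0 cle; rewrite /tradeoff; apply: lb_le_inf.
  exists (mean Q (fun x => 1 - (fun=> 0 : R) x)); exists (fun=> 0) => //.
  split; first exact: measurable_cst.
    by move=> x; rewrite lexx ler01.
  by rewrite (expectation_cst P 0) lee_fin.
move=> _ [phi [mphi phi01 Ele] <-].
have tphi : is_test phi by [].
rewrite -/(mean Q _) mean_onem//; apply: cle => //.
by rewrite -lee_fin -expectation_meanE.
Qed.

(* A test of level [alpha] for [P] becomes one for [P'] after multiplication
   by [alpha / (alpha + eps)]. *)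
Lemma tradeoff_perturb P Q P' Q' (alpha eps delta : R) :
  0 < alpha -> 0 <= eps -> 0 <= delta ->
  (forall phi, is_test phi -> mean P' phi <= mean P phi + eps) ->
  (forall phi, is_test phi -> mean Q phi <= mean Q' phi + delta) ->
  tradeoff P' Q' alpha <= tradeoff P Q alpha + (eps / alpha + delta).
Proof.
move=> a0 e0 de0 leP leQ; rewrite -lerBlDr; apply: tradeoff_ge; first exact: ltW.
move=> phi tphi Pphi.
have ae0 : 0 < alpha + eps by rewrite ltr_wpDr.
pose c := alpha / (alpha + eps).
have c01 : 0 <= c <= 1.
  by rewrite divr_ge0 ?(ltW a0) ?(ltW ae0)//= ler_pdivrMr// mul1r lerDl.
rewrite lerBlDr.
have /(tradeoff_le Q' (is_testZ c01 tphi)) :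
    mean P' (fun x => c * phi x) <= alpha.
  rewrite meanZ// /c mulrAC ler_pdivrMr// ler_pM2l//.
  by rewrite (le_trans (leP _ tphi))// lerD2r.
move=> /le_trans; apply; rewrite meanZ//.
have Qle := leQ _ tphi.
have /andP[Q0 Q1] := mean01 Q tphi.
have c1e : 1 - c <= eps / alpha.
  have -> : 1 - c = eps / (alpha + eps) by rewrite /c; field; rewrite gt_eqF.
  by rewrite ler_wpM2l// lef_pV2 ?posrE// lerDl.
(* The loss of power is at most [(1 - c) * mean Q phi + c * delta], as
   [mean Q' phi >= mean Q phi - delta]. *)
by case/andP: c01 => c0 c1; nra.
Qed.

End tradeoff.

(** Only the two means of a test matter, so a pair on which all tests of another pair can be
    imitated is at least as easy to tell apart. *)
Lemma tradeoff_reduction d d' (T : measurableType d) (T' : measurableType d')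
    (R : realType) (P Q : probability T R) (P' Q' : probability T' R) (alpha : R) :
  0 <= alpha ->
  (forall phi, is_test phi -> exists psi, [/\ is_test psi,
    mean P' psi = mean P phi & mean Q' psi = mean Q phi]) ->
  tradeoff P' Q' alpha <= tradeoff P Q alpha.
Proof.
move=> alpha0 red; apply: tradeoff_ge => // phi /red[psi [tpsi <- <-]].
exact: tradeoff_le.
Qed.

(** * Laws on the natural numbers: control by point masses *)

Section mass.
Context (R : realType).
Implicit Types (P Q : probability nat R) (phi : nat -> R).

Definition mass P (k : nat) : R := fine (P [set k]).

Lemma mass_ge0 P k : 0 <= mass P k.
Proof. by rewrite fine_ge0. Qed.

(** The head sum is the mean of [phi] cut off to 0 from [K] on. *)
Lemma head_sum_le_mean P phi K : is_test phi ->
  \sum_(k < K) phi k * mass P k <= mean P phi.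
Proof.
move=> tphi; have [mphi phi01] := tphi.
have phi0 k : 0 <= phi k by have /andP[] := phi01 k.
rewrite -(mean_step P _ (c := fun k : 'I_K => phi k)
  (A := fun k : 'I_K => [set nat_of_ord k]))//.
have stepE x : \sum_(k < K) phi k * \1_[set nat_of_ord k] x =
    if (x < K)%N then phi x else 0.
  case: ifPn => [xK|]; last first.
    rewrite -leqNgt => Kx; apply: big1 => k _.
    rewrite indicE memNset ?mulr0// => /= xk.
    by move: Kx; rewrite xk leqNgt ltn_ord.
  rewrite (bigD1 (Ordinal xK))//= indicE mem_set// mulr1 big1 ?addr0// => k kx.
  rewrite indicE memNset ?mulr0// => /= xk.
  by move/eqP: kx; apply; exact/val_inj.
apply: le_mean => //.
- split; first by [].
  by move=> x; rewrite stepE; case: ifP => // _; rewrite lexx ler01.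
- by move=> x; rewrite stepE; case: ifP.
Qed.

(** The preceding bound for [1 - phi]. The two together fix a mean up to the tail mass, without
    infinite series. *)
Lemma mean_le_head_sum P phi K : is_test phi ->
  mean P phi <= \sum_(k < K) phi k * mass P k + (1 - \sum_(k < K) mass P k).
Proof.
move=> tphi; have := head_sum_le_mean P K (is_test_onem tphi).
rewrite mean_onem//.
under eq_bigr do rewrite mulrBl mul1r.
rewrite sumrB; lra.
Qed.

(** Countable additivity over the singletons. *)
Lemma cvg_head_mass P : \sum_(k < K) mass P k @[K --> \oo] --> (1 : R).
Proof.
have trivI : trivIset [set: nat] (fun k : nat => [set k]).
  by move=> i j _ _ [x [/= -> ->]].
have bigcup1 : \bigcup_k [set k] = [set: nat].
  by apply/seteqP; split => // k _; exists k.
suff /fine_cvg : (\sum_(k < K) mass P k)%:E @[K --> \oo] --> (1 : R)%:E by [].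
rewrite (_ : (fun n => _) =
  (fun n => \sum_(0 <= k < n) P [set k])%E); last first.
  apply/funext => n; rewrite big_mkord -sumEFin; apply: eq_bigr => k _.
  by rewrite /mass fineK// fin_num_measure.
rewrite -(probability_setT P) -bigcup1.
exact: (measure_semi_sigma_additive _ _ trivI).
Qed.

Lemma small_tail_mass P (eps : R) : 0 < eps ->
  exists K : nat, 1 - \sum_(k < K) mass P k <= eps.
Proof.
move=> eps0; have /cvgrPdist_le/(_ _ eps0)[K _ /(_ K (leqnn _))] := cvg_head_mass P.
by move=> /ler_normlP[_]; exists K.
Qed.

(* Scheffe: pointwise convergence of the mass functions to one of total mass 1
   bounds the tails uniformly. *)
Lemma cvg_mean_uniform (P_ : nat -> probability nat R) P :
  (forall k, mass (P_ n) k @[n --> \oo] --> mass P k) ->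
  forall eps : R, 0 < eps -> \forall n \near \oo,
    forall phi, is_test phi -> `|mean (P_ n) phi - mean P phi| <= eps.
Proof.
move=> cvP eps eps0.
(* One third pays for the tail of [P]. The head discrepancy [D] is paid twice: between the head
   sums, and to bound the tail of [P_ n] by that of [P]. *)
have [K tailK] := small_tail_mass P (divr_gt0 eps0 (ltr0n R 3)).
have : \sum_(k < K) `|mass (P_ n) k - mass P k| @[n --> \oo] --> (0 : R).
  rewrite [X in _ --> X](_ : 0 = \sum_(k < K) `|mass P k - mass P k|); last first.
    by rewrite big1// => k _; rewrite subrr normr0.
  apply: cvg_big => [|k _]; first exact: add_continuous.
  apply: cvg_norm; apply: cvgB => //; exact: cvg_cst.
move=> /cvgrPdist_le/(_ _ (divr_gt0 eps0 (ltr0n R 3))) near_head.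
near=> n => phi tphi.
have Dle : \sum_(k < K) `|mass (P_ n) k - mass P k| <= eps / 3.
  by near: n; apply: filterS near_head => n; rewrite sub0r normrN => /ler_normlP[].
set D := \sum_(k < K) _ in Dle.
have [_ phi01] := tphi.
have headD : `|\sum_(k < K) phi k * mass (P_ n) k - \sum_(k < K) phi k * mass P k|
    <= D.
  rewrite -sumrB (le_trans (ler_norm_sum _ _ _))// ler_sum// => k _.
  rewrite -mulrBr normrM ler_piMl//.
  by have /andP[? ?] := phi01 k; rewrite ger0_norm.
have massD : `|\sum_(k < K) mass (P_ n) k - \sum_(k < K) mass P k| <= D.
  by rewrite -sumrB ler_norm_sum.
have := head_sum_le_mean P K tphi.
have := head_sum_le_mean (P_ n) K tphi.
have := mean_le_head_sum P K tphi.
have := mean_le_head_sum (P_ n) K tphi.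
move: headD massD; rewrite !ler_norml => /andP[? ?] /andP[? ?] *.
apply/andP; split; lra.
Unshelve. all: by end_near. Qed.

(** [tradeoff_perturb] in both directions; the infimum ranges over all tests, hence the appeal to
    convergence of means uniform in the test. *)
Lemma cvg_tradeoff (P_ Q_ : nat -> probability nat R) P Q (alpha : R) :
  0 < alpha ->
  (forall k, mass (P_ n) k @[n --> \oo] --> mass P k) ->
  (forall k, mass (Q_ n) k @[n --> \oo] --> mass Q k) ->
  tradeoff (P_ n) (Q_ n) alpha @[n --> \oo] --> tradeoff P Q alpha.
Proof.
move=> alpha0 cvP cvQ; apply/cvgrPdist_le => eps eps0.
(* Solves [delta / alpha + delta = eps], the error of [tradeoff_perturb] when both discrepancies are
   [delta]. *)
pose delta := eps / (alpha^-1 + 1).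
have V0 : 0 < alpha^-1 + 1 by rewrite addr_gt0// invr_gt0.
have delta0 : 0 < delta by rewrite divr_gt0.
have deltaE : delta / alpha + delta = eps by rewrite /delta; field; lra.
near=> n.
have Pn : forall phi, is_test phi -> `|mean (P_ n) phi - mean P phi| <= delta.
  by near: n; exact: cvg_mean_uniform.
have Qn : forall phi, is_test phi -> `|mean (Q_ n) phi - mean Q phi| <= delta.
  by near: n; exact: cvg_mean_uniform.
rewrite ler_distl -deltaE lerBlDr; apply/andP; split;
  apply: tradeoff_perturb => // [||phi /Pn|phi /Qn];
  by rewrite ?(ltW delta0)// ler_norml; lra.
Unshelve. all: by end_near. Qed.

(** A test of level 0 vanishes wherever [P] has mass, hence wherever [Q] has mass, and so has no
    power. The zero test attains 1. *)
Lemma tradeoff_abs_cont0 P Q : (forall k, mass P k = 0 -> mass Q k = 0) ->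
  tradeoff P Q 0 = 1.
Proof.
move=> PQ; apply/eqP; rewrite eq_le; apply/andP; split.
  rewrite -[leRHS]subr0 -[X in _ <= 1 - X](mean_cst Q 0).
  by apply: tradeoff_le; [apply: is_test_cst; lra|rewrite mean_cst].
apply: tradeoff_ge => // phi tphi Pphi.
have phi0 k : 0 <= phi k by have [_ /(_ k)/andP[]] := tphi.
rewrite lerBrDl -lerBrDr subrr; apply/ler_addgt0Pr => eps eps0; rewrite add0r.
have [K tailK] := small_tail_mass Q eps0.
apply: le_trans (mean_le_head_sum Q K tphi) _.
rewrite big1 ?add0r// => k _.
(* This product is the last term of the head sum of length [k.+1], which is at most
   [mean P phi <= 0]. *)
have : phi k * mass P k = 0.
  apply/eqP; rewrite eq_le mulr_ge0 ?mass_ge0// andbT (le_trans _ Pphi)//.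
  apply: le_trans (head_sum_le_mean P k.+1 tphi).
  rewrite big_ord_recr/= lerDr sumr_ge0// => i _.
  by rewrite mulr_ge0 ?mass_ge0.
by move/eqP; rewrite mulf_eq0 => /orP[/eqP->|/eqP/PQ->]; rewrite ?mul0r ?mulr0.
Qed.

End mass.

(** * Sufficiency of the number of ones *)

Section bernoulli_power.
Context (R : realType).
Implicit Types (p q r : R) (n k : nat).

Lemma big_count_partition (V : nmodType) n (F : n.-tuple bool -> V) :
  \sum_(t : n.-tuple bool) F t =
  \sum_(k < n.+1) \sum_(t : n.-tuple bool | count id t == k :> nat) F t.
Proof.
have ltn_count (t : n.-tuple bool) : (count id t < n.+1)%N.
  by rewrite ltnS -[X in (_ <= X)%N](size_tuple t) count_size.
rewrite (partition_big (fun t => Ordinal (ltn_count t)) xpredT)//=.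
Qed.

(** Tuples with [k] ones are the indicators of the [k]-element subsets of ['I_n]. *)
Lemma card_count n k :
  #|[set t : n.-tuple bool | count id t == k]%SET| = 'C(n, k).
Proof.
pose f (A : {set 'I_n}) : n.-tuple bool := [tuple i \in A | i < n].
have finj : injective f.
  move=> A B /(congr1 (fun t : n.-tuple bool => tnth t)) fAB.
  by apply/setP => i; have := congr1 (fun g => g i) fAB; rewrite !tnth_mktuple.
rewrite -[X in 'C(X, _)](card_ord n) -card_draws -(card_imset _ finj).
congr #|pred_of_set _|; apply/setP => t; rewrite inE; apply/idP/imsetP.
  move=> /eqP tk; exists [set i | tnth t i]%SET; last first.
    by apply: eq_from_tnth => i; rewrite tnth_mktuple inE.
  rewrite inE -tk -sum1_card -sum1_count big_tuple.
  by apply/eqP/eq_bigl => i; rewrite inE.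
move=> [A]; rewrite inE => /eqP <- ->; apply/eqP.
rewrite -sum1_card -sum1_count big_tuple.
by apply: eq_bigl => i; rewrite tnth_mktuple.
Qed.

Lemma measurable_tuple1 n (t : n.-tuple bool) : measurable [set t].
Proof.
rewrite (_ : [set t] = \bigcap_(i in [set: 'I_n])
    ((fun u : n.-tuple bool => tnth u i) @^-1` [set tnth t i])).
  apply: fin_bigcap_measurable => // i _; rewrite -[X in measurable X]setTI.
  exact: (measurable_tnth i).
apply/seteqP; split => [u -> //|u tu].
by apply: eq_from_tnth => i; exact: tu.
Qed.

(** The product sigma-algebra is discrete, so measurability of tests on bit tuples is automatic. *)
Lemma measurable_tuple_bool n (A : set (n.-tuple bool)) : measurable A.
Proof.
apply: countable_measurable; first exact: measurable_tuple1.
exact/finite_set_countable/finite_finset.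
Qed.

Lemma is_test_tuple_bool n (psi : n.-tuple bool -> R) :
  (forall t, 0 <= psi t <= 1) -> is_test psi.
Proof. by split => // _ Y _; exact: measurable_tuple_bool. Qed.

(** A singleton is a box. That its probability depends on [t] only through [count id t] is what
    makes the number of ones sufficient. *)
Lemma power_Ber1 p n (t : n.-tuple bool) : 0 <= p <= 1 ->
  power_probability (Ber p) n [set t] =
  (p ^+ count id t * (1 - p) ^+ (n - count id t))%:E.
Proof.
move=> p01; have -> : [set t] = [set u : n.-tuple bool |
    forall i, [set tnth t i] (tnth u i)].
  by apply/seteqP; split => [u -> //|u tu]; apply: eq_from_tnth.
rewrite (power_probability_box _ (A := fun i => [set tnth t i]))//.
have BerE b : Ber p [set b] = (if b then p else 1 - p)%:E.
  rewrite -[LHS]/(bernoulli_prob p [set b]) bernoulli_probE// !diracE.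
  have mem1 (a c : bool) : (a \in [set c]) = (a == c).
    by apply/idP/eqP => [/set_mem//|->]; exact: mem_set.
  by rewrite !mem1; case: b; rewrite mule1 mule0 ?adde0 ?add0e.
under eq_bigr do rewrite BerE.
rewrite prodEFin -(big_tuple _ _ t xpredT (fun b : bool => if b then p else (1 - p))).
congr EFin; rewrite -[X in (X - _)%N](size_tuple t).
elim: (t : seq bool) => [|b s IH]; first by rewrite big_nil mulr1.
rewrite big_cons IH; case: b => /=; first by rewrite add1n exprS subSS mulrA.
by rewrite add0n subSn ?count_size// exprS mulrCA.
Qed.

Lemma mean_power_Ber p n (psi : n.-tuple bool -> R) :
  0 <= p <= 1 -> (forall t, 0 <= psi t) ->
  mean (power_probability (Ber p) n) psi =
  \sum_(t : n.-tuple bool) psi t * (p ^+ count id t * (1 - p) ^+ (n - count id t)).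
Proof.
move=> p01 psi0.
rewrite (_ : psi = fun x => \sum_t psi t * \1_[set t] x); last first.
  apply/funext => x; rewrite (bigD1 x)//= indicE mem_set// mulr1 big1 ?addr0//.
  by move=> t /eqP tx; rewrite indicE memNset ?mulr0// => /= xt; exact: tx.
rewrite mean_step//; last by move=> t; exact: measurable_tuple_bool.
apply: eq_bigr => t _; rewrite power_Ber1//=; congr (_ * _).
(* Expanding [psi] also expanded [psi t] on the right-hand side; that sum collapses to its diagonal
   term. *)
rewrite (bigD1 t)//= indicE mem_set// mulr1 big1 ?addr0// => u /eqP ut.
by rewrite indicE memNset ?mulr0// => /= tu; exact: ut.
Qed.

Lemma mean_binomial p n (phi : nat -> R) :
  0 <= p <= 1 -> (forall k, 0 <= phi k) ->
  mean (binomial_prob n p) phi =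
  \sum_(k < n.+1) phi k * (p ^+ k * (1 - p) ^+ (n - k) *+ 'C(n, k)).
Proof.
move=> /andP[p0 p1] phi0; rewrite /mean unlock.
rewrite (@integral_binomial _ n p p0 p1) => [|k]; last by rewrite lee_fin.
under eq_bigr do rewrite -EFinM mulrC.
by rewrite sumEFin.
Qed.

(* Replacing a test by its average over the tuples with [k] ones changes
   neither mean. *)
Lemma tradeoff_power_Ber p q n (alpha : R) :
  0 <= p <= 1 -> 0 <= q <= 1 -> 0 <= alpha ->
  tradeoff (power_probability (Ber p) n) (power_probability (Ber q) n) alpha =
  tradeoff (binomial_prob n p) (binomial_prob n q) alpha.
Proof.
move=> p01 q01 alpha0; apply/eqP; rewrite eq_le; apply/andP; split.
  (* A test on counts becomes one on tuples by composition with the number of ones. *)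
  apply: tradeoff_reduction => // phi [_ phi01].
  have phi0 k : 0 <= phi k by have /andP[] := phi01 k.
  have meanE r : 0 <= r <= 1 ->
      mean (power_probability (Ber r) n) (fun t => phi (count id t)) =
      mean (binomial_prob n r) phi.
    move=> r01; rewrite mean_power_Ber// mean_binomial// big_count_partition.
    apply: eq_bigr => k _.
    under eq_bigr => t /eqP -> do [].
    rewrite sumr_const mulrnAr -card_count; congr (_ *+ _).
    by apply: eq_card => t; rewrite inE.
  exists (fun t : n.-tuple bool => phi (count id t)); split; try exact: meanE.
  exact: is_test_tuple_bool.
apply: tradeoff_reduction => // psi [_ psi01].
have psi0 t : 0 <= psi t by have /andP[] := psi01 t.
(* For [k > n] the divisor is 0 and [phi k] is 0, still a legitimate value of a test. *)
pose phi k := (\sum_(t : n.-tuple bool | count id t == k) psi t) / 'C(n, k)%:R.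
have phi01 k : 0 <= phi k <= 1.
  rewrite /phi divr_ge0 ?sumr_ge0//=; have [->|Cn0] := eqVneq 'C(n, k) 0.
    by rewrite invr0 mulr0.
  rewrite ler_pdivrMr ?ltr0n ?lt0n// mul1r -card_count -sum1_card natr_sum.
  under [leRHS]eq_bigl do rewrite inE.
  by apply: ler_sum => t _; have /andP[] := psi01 t.
have phi0 k : 0 <= phi k by have /andP[] := phi01 k.
have meanE r : 0 <= r <= 1 -> mean (binomial_prob n r) phi =
    mean (power_probability (Ber r) n) psi.
  move=> r01; rewrite mean_power_Ber// mean_binomial// big_count_partition.
  apply: eq_bigr => k _.
  rewrite -mulr_natl mulrA divfK; last first.
    by rewrite pnatr_eq0 -lt0n bin_gt0 -ltnS.
  by rewrite mulr_suml; apply: eq_bigr => t /eqP ->.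
exists phi; split; try exact: meanE.
by split.
Qed.

End bernoulli_power.

(** * Poisson limit of the binomial masses *)

Section poisson_limit.
Context (R : realType).
Implicit Types (lambda p : R) (n k : nat).

Lemma mass_binomial p n k : 0 <= p <= 1 ->
  mass (binomial_prob n p) k = p ^+ k * (1 - p) ^+ (n - k) *+ 'C(n, k).
Proof.
move=> p01; rewrite /mass -[X in fine X]/(binomial_prob n p [set k]).
by rewrite /binomial_prob p01 esum_set1 // lee_fin binomial_pmf_ge0.
Qed.

Lemma mass_poisson lambda k : 0 < lambda ->
  mass (poisson lambda) k = lambda ^+ k * (k`!%:R)^-1 * expR (- lambda).
Proof.
move=> l0; rewrite /mass -[X in fine X]/(poisson_prob lambda 0%N [set k]).
rewrite /poisson_prob l0 esum_set1 ?lee_fin ?poisson_pmf_ge0//=.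
by rewrite /poisson_pmf l0.
Qed.

Lemma cvg_divn (c : R) : c / n%:R @[n --> \oo] --> 0.
Proof.
rewrite -[X in _ --> X](mulr0 c); apply: cvgM; first exact: cvg_cst.
apply/gtr0_cvgV0; last exact: cvgr_idn.
by near=> n; rewrite ltr0n; near: n; exact: nbhs_infty_gt.
Unshelve. all: by end_near. Qed.

(** Passing from [k] to [k.+1] multiplies the ratio by [(1 - k / n) / k.+1]. *)
Lemma cvg_bin_div k :
  ('C(n, k)%:R / n%:R ^+ k : R) @[n --> \oo] --> (k`!%:R^-1 : R).
Proof.
elim: k => [|k IH].
  rewrite (_ : (fun n => _) = (fun=> 0`!%:R^-1)); first exact: cvg_cst.
  by apply/funext => n; rewrite bin0 expr0 divr1 fact0 invr1.
apply: (@cvg_trans _ ('C(n, k)%:R / n%:R ^+ k * (1 - k%:R / n%:R) / k.+1%:R @[n --> \oo])).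
  apply: near_eq_cvg; near=> n.
  have n0 : (0 < n)%N by near: n; exact: nbhs_infty_gt.
  have kn : (k <= n)%N by near: n; exact: nbhs_infty_ge.
  have nR0 : n%:R != 0 :> R by rewrite pnatr_eq0 -lt0n.
  have := congr1 (fun m => m%:R : R) (mul_bin_left n k).
  rewrite /= !natrM natrB// => binS.
  have -> : 'C(n, k.+1)%:R = (n%:R - k%:R) * 'C(n, k)%:R / k.+1%:R :> R.
    by rewrite -binS mulrC mulKf// pnatr_eq0.
  rewrite exprS; field.
  by rewrite expf_neq0// nR0 nat1r pnatr_eq0.
rewrite factS natrM invfM mulrC -[X in X * _]mulr1 -[X in _ * X * _]subr0.
apply: cvgM; last exact: cvg_cst.
apply: cvgM => //.
by apply: cvgB; [exact: cvg_cst|exact: cvg_divn].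
Unshelve. all: by end_near. Qed.

(* Squeeze: [expR (- x / (1 - x)) <= 1 - x <= expR (- x)] for [0 < x < 1]. *)
Lemma cvg_exp_1B_divn lambda k : 0 < lambda ->
  (1 - lambda / n%:R) ^+ (n - k) @[n --> \oo] --> expR (- lambda).
Proof.
move=> l0.
have cvup : - (lambda * (1 - k%:R / n%:R)) @[n --> \oo] --> - lambda.
  apply: cvgN; rewrite -[X in _ --> X]mulr1; apply: cvgM; first exact: cvg_cst.
  rewrite -[X in _ --> X]subr0.
  by apply: cvgB; [exact: cvg_cst|exact: cvg_divn].
have cvlo : - (lambda * (1 - k%:R / n%:R)) / (1 - lambda / n%:R) @[n --> \oo]
    --> - lambda.
  rewrite -[X in _ --> X]divr1; apply: cvgM => //.
  apply: cvgV; first exact: oner_neq0.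
  rewrite -[X in _ --> X]subr0.
  by apply: cvgB; [exact: cvg_cst|exact: cvg_divn].
apply: (@squeeze_cvgr _ _ _ _
  (fun n => expR (- (lambda * (1 - k%:R / n%:R)) / (1 - lambda / n%:R)))
  (fun n => expR (- (lambda * (1 - k%:R / n%:R))))); last 2 first.
- exact: (continuous_cvg _ (@continuous_expR R _)).
- exact: (continuous_cvg _ (@continuous_expR R _)).
near=> n.
have n0 : (0 < n%:R :> R) by rewrite ltr0n; near: n; exact: nbhs_infty_gt.
have kn : (k <= n)%N by near: n; exact: nbhs_infty_ge.
have ln : lambda < n%:R by near: n; exact: nbhs_infty_gtr.
set x := lambda / n%:R.
have x0 : 0 < x by rewrite divr_gt0.
have x1 : 0 < 1 - x by rewrite subr_gt0 ltr_pdivrMr// mul1r.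
(* Makes both bounds [(n - k)]-th powers, so that the inequalities for [1 - x] can be raised to that
   power. *)
have expE : lambda * (1 - k%:R / n%:R) = x *+ (n - k).
  by rewrite -[RHS]mulr_natr natrB// /x; field; rewrite gt_eqF.
rewrite expE; apply/andP; split; last first.
  rewrite -mulNrn -mulr_natr expRM_natr lerXn2r ?nnegrE ?expR_ge0 ?(ltW x1)//.
  exact: expR_ge1Dx.
have -> : - (x *+ (n - k)) / (1 - x) = - (x / (1 - x)) *+ (n - k).
  by rewrite mulNrn mulNr mulrnAl.
rewrite -mulr_natr expRM_natr lerXn2r ?nnegrE ?expR_ge0 ?(ltW x1)//.
(* After inversion the lower bound reads [1 / (1 - x) = 1 + x / (1 - x) <= expR (x / (1 - x))]. *)
rewrite expRN -[leRHS]invrK lef_pV2 ?posrE ?expR_gt0 ?invr_gt0//.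
apply: le_trans (expR_ge1Dx _).
by rewrite le_eqVlt; apply/orP; left; apply/eqP; field; rewrite gt_eqF.
Unshelve. all: by end_near. Qed.

(** The law of rare events: once [n > lambda], the mass factors into [lambda ^+ k],
    ['C(n, k) / n ^+ k] and [(1 - lambda / n) ^+ (n - k)], whose limits are known. *)
Lemma cvg_mass_binomial lambda k : 0 < lambda ->
  mass (binomial_prob n (lambda / n%:R)) k @[n --> \oo] --> mass (poisson lambda) k.
Proof.
move=> l0; rewrite mass_poisson//.
apply: (@cvg_trans _ (lambda ^+ k * ('C(n, k)%:R / n%:R ^+ k) *
    (1 - lambda / n%:R) ^+ (n - k) @[n --> \oo])).
  apply: near_eq_cvg; near=> n.
  have n0 : (0 < n%:R :> R) by rewrite ltr0n; near: n; exact: nbhs_infty_gt.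
  have ln : lambda < n%:R by near: n; exact: nbhs_infty_gtr.
  rewrite mass_binomial; last first.
    by rewrite divr_ge0 ?(ltW l0) ?(ltW n0)//= ler_pdivrMr// mul1r ltW.
  by rewrite -mulr_natr expr_div_n; ring.
apply: cvgM; last exact: cvg_exp_1B_divn.
by apply: cvgM; [exact: cvg_cst|exact: cvg_bin_div].
Unshelve. all: by end_near. Qed.

End poisson_limit.

(** * Convergence at positive levels and at level 0 *)

Unset Implicit Arguments.

(* The terms of the sequence with n < max lambda1 lambda2 do not affect its
   limit. *)
Theorem corollary9 (R : realType) (lambda1 lambda2 : R)
    (lambda1_gt0 : 0 < lambda1) (lambda2_gt0 : 0 < lambda2) :
  forall alpha : R, 0 <= alpha <= 1 ->
    (fun n : nat =>
       tradeoff (power_probability (Ber (lambda1 / n%:R)) n)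
                (power_probability (Ber (lambda2 / n%:R)) n) alpha)
      @ \oo
    --> tradeoff (poisson lambda1) (poisson lambda2) alpha.
Proof.
move=> alpha /andP[alpha0 _].
have divn_itv (lambda : R) (n : nat) : 0 < lambda -> lambda < n%:R ->
    0 < lambda / n%:R < 1.
  move=> l0 ln; have n0 : 0 < n%:R :> R := lt_trans l0 ln.
  by rewrite divr_gt0//= ltr_pdivrMr// mul1r.
apply: (@cvg_trans _ (tradeoff (binomial_prob n (lambda1 / n%:R))
    (binomial_prob n (lambda2 / n%:R)) alpha @[n --> \oo])).
  apply: near_eq_cvg; near=> n.
  have /andP[? ?] : 0 < lambda1 / n%:R < 1.
    by apply: divn_itv => //; near: n; exact: nbhs_infty_gtr.
  have /andP[? ?] : 0 < lambda2 / n%:R < 1.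
    by apply: divn_itv => //; near: n; exact: nbhs_infty_gtr.
  by rewrite tradeoff_power_Ber// !ltW.
(* Level 0 is treated apart because the perturbation bound divides by [alpha]. *)
move: alpha0; rewrite le_eqVlt => /orP[/eqP<-|alpha0]; last first.
  by apply: cvg_tradeoff => // k; exact: cvg_mass_binomial.
(* All Poisson masses are positive, so absolute continuity holds vacuously. *)
rewrite tradeoff_abs_cont0; last first.
  move=> k /eqP; rewrite mass_poisson// gt_eqF//.
  by rewrite !mulr_gt0 ?exprn_gt0 ?expR_gt0// invr_gt0 ltr0n fact_gt0.
apply: cvg_near_cst; near=> n.
have /andP[p0 p1] : 0 < lambda1 / n%:R < 1.
  by apply: divn_itv => //; near: n; exact: nbhs_infty_gtr.
have /andP[q0 q1] : 0 < lambda2 / n%:R < 1.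
  by apply: divn_itv => //; near: n; exact: nbhs_infty_gtr.
(* For parameters strictly between 0 and 1 a binomial mass vanishes only where ['C(n, k)] does, a
   condition common to both laws. *)
apply: tradeoff_abs_cont0 => k.
rewrite !mass_binomial ?(ltW p0) ?(ltW p1) ?(ltW q0) ?(ltW q1)// => /eqP.
rewrite mulrn_eq0 mulf_eq0 !expf_eq0 subr_eq0 (gt_eqF p1) (gt_eqF p0) !andbF.
by rewrite !orbF => /eqP ->; rewrite mulr0n.
Unshelve. all: by end_near. Qed.
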